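(* Let $\alpha\in\mathbb R$ be irrational, $R_\alpha\colon\mathbb T\to\mathbb T$ the rotation $\theta\mapsto\theta+\alpha$ of the circle $\mathbb T=\mathbb R/\mathbb Z$, and let $A\subset\mathbb T$ be a nonempty countable $R_\alpha$-invariant set. Then the Sturmian like cascade $\mathrm{Split}(\mathbb T,R_\alpha;A)$ is tame$_{\mathbf 2}$ (but it is not HNS).
   Context: $\mathrm{Split}(\mathbb T,R_\alpha;A)$ is the $\mathbb Z$-system $(X,T)$ obtained by splitting the points of $A$: $X$ is the circularly ordered set obtained from $\mathbb T$ by replacing each $a\in A$ by two points $a^-,a^+$ with $a^-$ immediately preceding $a^+$ (for $\theta\notin A$ put $\theta^-=\theta^+=\theta$), endowed with its interval topology. Explicitly, with $\pi\colon X\to\mathbb T$ the natural projection, for $\theta\notin A$ a neighborhood base at $\theta$ is $\pi^{-1}(\theta-\varepsilon,\theta+\varepsilon)$, while for $a\in A$ neighborhood bases at $a^-$ and $a^+$ are $\{a^-\}\cup\pi^{-1}(a-\varepsilon,a)$ and $\{a^+\}\cup\pi^{-1}(a,a+\varepsilon)$ ($\varepsilon>0$ small). The homeomorphism is $T(\theta^{\pm})=(\theta+\alpha)^{\pm}$. $X$ is compact and metrizable. The enveloping semigroup $E(X,T)$ is the closure of $\{T^n:n\in\mathbb Z\}$ in $X^X$ with the pointwise topology; $(X,T)$ is tame$_{\mathbf 2}$ if $E(X,T)$ is hereditarily separable (every subspace is separable). With $d$ a compatible metric, a system $(B,T)$ is nonsensitive if for every $\varepsilon>0$ there is a nonempty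 open $O\subset B$ with $\mathrm{diam}(T^nO)<\varepsilon$ for all $n\in\mathbb Z$; $(X,T)$ is HNS (hereditarily nonsensitive) if every nonempty closed $T$-invariant subset $B\subset X$ is nonsensitive. *)

(* Defs.v *)
From HB Require Import structures.
From mathcomp Require Import all_boot all_order all_algebra.
From mathcomp Require Import generic_quotient ring_quotient.
From mathcomp Require Import all_classical all_reals all_analysis.
From mathcomp Require Import lra.

Set Implicit Arguments.
Unset Strict Implicit.
Unset Printing Implicit Defensive.
Import Order.TTheory GRing.Theory Num.Theory.
Import numFieldNormedType.Exports.
Local Open Scope classical_set_scope.
Local Open Scope ring_scope.

Definition compatible_metric (R : realType) (X : topologicalType)
    (d : X -> X -> R) : Prop :=
  [/\ forall x y, d x y = 0 <-> x = y,
      forall x y, d x y = d y x,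
      forall x y z, d x z <= d x y + d y z
    & forall x, nbhs x =
        filter_from [set e : R | 0 < e] (fun e => [set y | d x y < e])].

Record cascade (R : realType) := Cascade {
  cascade_space :> topologicalType;
  cascade_compact : compact [set: cascade_space];
  cascade_metrizable :
    exists d : cascade_space -> cascade_space -> R, compatible_metric d;
  cascade_map : cascade_space -> cascade_space;
  cascade_inv : cascade_space -> cascade_space;
  cascade_mapK : cancel cascade_map cascade_inv;
  cascade_invK : cancel cascade_inv cascade_map;
  cascade_map_continuous : continuous cascade_map;
  cascade_inv_continuous : continuous cascade_inv
}.

Section cascade_notions.
Context {R : realType} (X : cascade R).

Definition cascade_iter (n : int) : X -> X :=
  match n with
  | Posz k => iter k (@cascade_map R X)
  | Negz k => iter k.+1 (@cascade_inv R X)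
  end.

Definition enveloping_semigroup : set {ptws X -> X} :=
  closure (range cascade_iter : set {ptws X -> X}).

Definition invariant (B : set X) : Prop := @cascade_map R X @` B = B.

Definition diam (d : X -> X -> R) (S : set X) : \bar R :=
  ereal_sup [set (d p.1 p.2)%:E | p in S `*` S].

(* The relatively open subsets of [B] are the [U `&` B] with [U] open. *)
Definition nonsensitive (d : X -> X -> R) (B : set X) : Prop :=
  forall e : R, 0 < e -> exists U : set X,
    [/\ open U, U `&` B !=set0
      & forall n : int, (diam d (cascade_iter n @` (U `&` B)) < e%:E)%E].

(* The space of a cascade is compact and metrizable: compatible metrics exist,
   and any two are uniformly equivalent, so that whether [X] is HNS does not
   depend on the choice of [d]. *)
Definition HNS : Prop :=
  forall d : X -> X -> R, compatible_metric d ->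
  forall B : set X, B !=set0 -> closed B -> invariant B -> nonsensitive d B.

End cascade_notions.
Arguments enveloping_semigroup {R} X.

Definition hereditarily_separable (Y : topologicalType) (E : set Y) : Prop :=
  forall S : set Y, S `<=` E ->
    exists D : set Y, [/\ D `<=` S, countable D & S `<=` closure D].

Definition tame2 (R : realType) (X : cascade R) : Prop :=
  hereditarily_separable (enveloping_semigroup X).

Section metrization.
Context {R : realType} {X : topologicalType} (f : nat -> X -> R).
Hypothesis Xcompact : compact [set: X].
Hypothesis f01 : forall k x, 0 <= f k x <= 1.
Hypothesis fcont : forall k, continuous (f k).
Hypothesis fsep : forall x y, (forall k, f k x = f k y) -> x = y.

Let D k x y := `|f k x - f k y| / k.+1%:R.
Let d x y := sup (range (fun k => D k x y)).

Let D_ge0 k x y : 0 <= D k x y.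
Proof. by rewrite /D divr_ge0. Qed.

Let D_le k x y : D k x y <= k.+1%:R^-1.
Proof.
rewrite /D ler_piMl// ler_norml.
have /andP[? ?] := f01 k x; have /andP[? ?] := f01 k y.
by apply/andP; split; lra.
Qed.

Let ubD x y : ubound (range (fun k => D k x y)) 1.
Proof.
by move=> _ [k _ <-]; rewrite (le_trans (D_le _ _ _))// invf_le1// ler1n.
Qed.

Let D_le_d k x y : D k x y <= d x y.
Proof. by apply: ub_le_sup; [exists 1; exact: ubD|exists k]. Qed.

Let d_le x y c : (forall k, D k x y <= c) -> d x y <= c.
Proof.
by move=> h; apply: ge_sup; [exists (D 0 x y), 0%N|move=> _ [k _ <-]].
Qed.

Let d_eq0 x y : d x y <= 0 -> x = y.
Proof.
move=> dxy; apply: fsep => k; apply/eqP; rewrite -subr_eq0 -normr_le0.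
by have := le_trans (D_le_d k x y) dxy; rewrite pmulr_lle0.
Qed.

Let d_xx x : d x x = 0.
Proof.
apply/eqP; rewrite eq_le (le_trans (D_ge0 0 _ _) (D_le_d _ _ _)) andbT.
by apply: d_le => k; rewrite /D subrr normr0 mul0r.
Qed.

Let near_d x e : 0 < e -> \forall y \near x, d x y < e.
Proof.
move=> e0; have e20 : 0 < e / 2 by rewrite divr_gt0.
pose N := Num.bound (e / 2)^-1.
have HN : N.+1%:R^-1 <= e / 2.
  rewrite -[leRHS]invrK lef_pV2 ?posrE ?invr_gt0//.
  apply: ltW; apply: (lt_trans (archi_boundP _)); first by rewrite invr_ge0 ltW.
  by rewrite ltr_nat.
have : \forall y \near x, forall k : 'I_N.+1, `|f k x - f k y| < e / 2.
  apply: filter_forall => k.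
  by have /cvgrPdist_lt := @fcont k x; apply.
apply: filterS => y h; apply: (@le_lt_trans _ _ (e / 2)); last first.
  by rewrite ltr_pdivrMr// ltr_pMr// ltr1n.
apply: d_le => k; have [kN|Nk] := ltnP k N.+1.
  apply: le_trans (ltW (h (Ordinal kN))).
  by rewrite /D /= ler_piMr// invf_le1// ler1n.
apply: le_trans (D_le _ _ _) (le_trans _ HN).
by rewrite lef_pV2 ?posrE// ler_nat (leq_trans Nk).
Qed.

Let d_sym x y : d x y = d y x.
Proof.
by rewrite /d; congr (sup (_ @` _)); apply/funext => k; rewrite /D distrC.
Qed.

Let d_triangle x y z : d x z <= d x y + d y z.
Proof.
apply: d_le => k; apply: le_trans (lerD (D_le_d k x y) (D_le_d k y z)).
by rewrite /D -mulrDl ler_pM2r// ?invr_gt0// ler_distD.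
Qed.

Lemma separating_metrizable : exists d : X -> X -> R, compatible_metric d.
Proof.
exists d; split=> //.
  by move=> x y; split=> [dxy|->//]; apply: d_eq0; rewrite dxy.
move=> x; apply/seteqP; split=> [U xU|U [e /= e0 eU]]; last first.
  exact: filterS eU (near_d _ e0).
apply: contrapT => h.
pose F := filter_from [set e : R | 0 < e] (fun e => [set y | d x y < e] `\` U).
have FF : ProperFilter F.
  apply: filter_from_proper.
    apply: filter_from_filter; first by exists 1 => /=.
    move=> i j /= i0 j0; exists (Num.min i j); first by rewrite /= lt_min i0.
    by move=> y /= [+ nU]; rewrite lt_min => /andP[].
  move=> e e0; apply: contrapT => h'; apply: h; exists e => // y dy.
  by apply: contrapT => nU; apply: h'; exists y.
have [y [_ cy]] := Xcompact FF filterT.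
have xy : x = y.
  apply: d_eq0; apply/ler_addgt0Pl => e e0; rewrite addr0.
  have e2 : 0 < e / 2 by rewrite divr_gt0.
  have [||z [/= [xz _] yz]] := cy ([set z | d x z < e / 2] `\` U)
    [set z | d y z < e / 2].
  - by exists (e / 2).
  - exact: near_d.
  apply: le_trans (d_triangle x z y) _; rewrite (d_sym z) [leRHS]splitr.
  by rewrite lerD// ltW.
have [||z [[_ nU] Uz]] := cy ([set z | d x z < 1] `\` U) U.
- by exists 1 => /=.
- by rewrite -xy.
by [].
Qed.

End metrization.

Section circle.
Context {R : realType}.

Definition integers : zmodClosed R :=
  GRing.ZmodClosed.clone R (@Num.int_num_subdef R) _.

Definition circle : Type := Quotient.quot integers.
HB.instance Definition _ := GRing.Zmodule.on circle.

Definition proj (t : R) : circle := (\pi_circle t)%qT.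

Definition rotation (alpha : R) (theta : circle) : circle := theta + proj alpha.

(* The open arc (theta + u, theta + v). *)
Definition arc (theta : circle) (u v : R) : set circle :=
  [set theta + proj t | t in `]u, v[].

Lemma proj_eq (s t : R) : proj s = proj t <-> s - t \is a Num.int.
Proof.
by split=> [|h]; [move/eqP|apply/eqP]; rewrite -[_ == _]Quotient.idealrBE.
Qed.

Lemma projD (s t : R) : proj (s + t) = proj s + proj t.
Proof. exact: (@pi_addr _ _ _ _ _ (Quotient.quot integers)). Qed.

Lemma proj0 : proj 0 = 0.
Proof. exact: (@pi_zeror _ _ _ _ _ (Quotient.quot integers)). Qed.

Lemma projN (t : R) : proj (- t) = - proj t.
Proof. exact: (@pi_oppr _ _ _ _ _ (Quotient.quot integers)). Qed.

Lemma proj_repr (theta : circle) : proj (repr theta) = theta.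
Proof. exact: reprK. Qed.

Definition frac (theta : circle) : R :=
  repr theta - (Num.floor (repr theta))%:~R.

Lemma frac_ge0 theta : 0 <= frac theta.
Proof. by rewrite subr_ge0 floor_le. Qed.

Lemma frac_lt1 theta : frac theta < 1.
Proof. by rewrite ltrBlDl -intrD1 floorD1_gt. Qed.

Lemma proj_frac theta : proj (frac theta) = theta.
Proof.
rewrite -[RHS]proj_repr; apply/proj_eq.
by rewrite /frac addrAC subrr add0r rpredN intr_int.
Qed.

Lemma proj_inj (s t : R) : `|s - t| < 1 -> proj s = proj t -> s = t.
Proof.
move=> st /proj_eq sti; apply/eqP; rewrite -subr_eq0; apply: contraLR st => h.
by rewrite -leNgt norm_intr_ge1.
Qed.

Lemma arc_mono theta (u v u' v' : R) : u' <= u -> v <= v' ->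
  arc theta u v `<=` arc theta u' v'.
Proof.
move=> uu vv y [t]; rewrite /= in_itv/= => /andP[? ?] ty.
by exists t => //; rewrite /= in_itv/=; apply/andP; split; lra.
Qed.

Lemma arc_open theta (u v : R) eta : arc theta u v eta ->
  exists2 e : R, 0 < e & arc eta (- e) e `<=` arc theta u v.
Proof.
case=> t; rewrite /= in_itv/= => /andP[ut tv] <-.
exists (Num.min (t - u) (v - t)); first by rewrite lt_min !subr_gt0 ut.
move=> y [s]; rewrite /= in_itv/= => /andP[+ +] sy; rewrite -{}sy.
rewrite lt_min ltrNl lt_min => /andP[? ?] /andP[? ?].
exists (t + s); last by rewrite projD addrA.
by rewrite /= in_itv/=; apply/andP; split; lra.
Qed.

Lemma arc_rotation alpha theta (u v : R) :
  rotation alpha @` arc theta u v = arc (rotation alpha theta) u v.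
Proof.
apply/seteqP; split=> [_ [_ [t tuv <-] <-]|_ [t tuv <-]].
  by exists t => //; rewrite /rotation addrAC.
by exists (theta + proj t); [exists t|rewrite /rotation addrAC].
Qed.

End circle.
Arguments circle : clear implicits.

(* [(theta, false)] is [theta^-] and [(theta, true)] is [theta^+]; the second
   point is present only over the points of [A], where they differ. *)
Definition split_space (R : realType) (A : set (circle R)) : Type :=
  {p : circle R * bool | p.2 ==> (p.1 \in A)}.
HB.instance Definition _ (R : realType) (A : set (circle R)) :=
  Choice.on (split_space A).

Section split_space.
Context {R : realType} {A : set (circle R)}.
Local Notation X := (split_space A).
Implicit Types x y : X.

Definition base x : circle R := (val x).1.
Definition side x : bool := (val x).2.

Fact split_pt_subproof (theta : circle R) (s : bool) :
  (s && (theta \in A)) ==> (theta \in A).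
Proof. by apply/implyP => /andP[]. Qed.

(* [theta^-] if [s] is [false] and [theta^+] if [s] is [true], with the
   convention [theta^- = theta^+] outside [A]. *)
Definition split_pt (theta : circle R) (s : bool) : X :=
  exist _ (theta, s && (theta \in A)) (split_pt_subproof theta s).

(* The basic neighborhoods of [theta], [a^-] and [a^+] respectively:
   [base^-1 (theta - e, theta + e)], [{a^-} u base^-1 (a - e, a)] and
   [{a^+} u base^-1 (a, a + e)]. *)
Definition split_base x (e : R) : set X :=
  if base x \in A then
    [set x] `|` base @^-1` (if side x then arc (base x) 0 e
                            else arc (base x) (- e) 0)
  else base @^-1` arc (base x) (- e) e.

Definition split_nbhs x : set_system X :=
  filter_from [set e : R | 0 < e] (split_base x).

Lemma base_split_pt theta s : base (split_pt theta s) = theta.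
Proof. by []. Qed.

Lemma side_split_pt theta s : side (split_pt theta s) = s && (theta \in A).
Proof. by []. Qed.

Lemma split_ptE x : split_pt (base x) (side x) = x.
Proof.
apply: val_inj => /=; rewrite /base /side.
by case: x => -[theta [|]] //= h; rewrite h.
Qed.

Lemma split_eq x y : base x = base y -> side x = side y -> x = y.
Proof. by move=> bxy sxy; rewrite -(split_ptE x) bxy sxy split_ptE. Qed.

Lemma side_in x : side x -> base x \in A.
Proof. by rewrite /side /base; case: x => -[theta s] /= /implyP. Qed.

Lemma split_base_refl x (e : R) : 0 < e -> split_base x e x.
Proof.
move=> e0; rewrite /split_base; case: ifP => _; first by left.
exists 0; last by rewrite proj0 addr0.
by rewrite /= in_itv/= oppr_lt0 e0.
Qed.

Lemma split_base_arc x (e : R) : 0 < e ->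
  split_base x e `<=` base @^-1` arc (base x) (- e) e.
Proof.
move=> e0 y; rewrite /split_base; case: ifP => _ //.
case=> [->|].
  exists 0; last by rewrite proj0 addr0.
  by rewrite /= in_itv/= oppr_lt0 e0.
by case: side => /=; apply: arc_mono; lra.
Qed.

Lemma split_base_mono x (e e' : R) : e <= e' ->
  split_base x e `<=` split_base x e'.
Proof.
move=> ee y; rewrite /split_base; case: ifP => _; last first.
  by apply: arc_mono; lra.
case=> [->|]; first by left.
by case: side => h; right; move: h; apply: arc_mono; lra.
Qed.

Lemma nbhs_base_arc x theta (u v : R) : arc theta u v (base x) ->
  split_nbhs x (base @^-1` arc theta u v).
Proof.
move=> /arc_open[e e0 h]; exists e => // y /(split_base_arc e0); exact: h.
Qed.

Lemma split_nbhs_filter x : ProperFilter (split_nbhs x).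
Proof.
apply: filter_from_proper; last first.
  by move=> e e0; exists x; exact: split_base_refl.
apply: filter_from_filter; first by exists 1 => /=.
move=> i j /= i0 j0; exists (Num.min i j); first by rewrite /= lt_min i0.
by move=> y h; split; apply: split_base_mono h; rewrite ge_min lexx ?orbT.
Qed.

Lemma split_nbhs_singleton x (U : set X) : split_nbhs x U -> U x.
Proof. by case=> e e0; apply; exact: split_base_refl. Qed.

Lemma split_nbhs_nbhs x (U : set X) :
  split_nbhs x U -> split_nbhs x (split_nbhs^~ U).
Proof.
move=> [e e0 eU]; exists e => // y.
have key theta u v : base @^-1` arc theta u v `<=` U ->
    arc theta u v (base y) -> split_nbhs y U.
  move=> h /nbhs_base_arc [d d0 dU]; exists d => // z /dU; exact: h.
rewrite {1}/split_base; move: eU; rewrite {1}/split_base; case: ifP => xA eU.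
  case=> [->|]; first by exists e => // z; rewrite /split_base xA => /eU.
  move: eU; case: side => eU; apply: key => z h; apply: eU; right; exact: h.
by apply: key => z h; apply: eU.
Qed.

HB.instance Definition _ := hasNbhs.Build X split_nbhs.
HB.instance Definition _ := Nbhs_isNbhsTopological.Build X
  split_nbhs_filter split_nbhs_singleton split_nbhs_nbhs.

Lemma split_compact : compact [set: X].
Proof.
rewrite compact_ultra => F UF _.
have FF : ProperFilter F by exact: ultra_proper.
pose r x : R := frac (base x).
have rF : (r @ F) [set` `[0, 1]].
  apply: (@filterS _ F _ setT) => [x _|]; last exact: filterT.
  rewrite /=.
  by rewrite in_itv/= frac_ge0 ltW ?frac_lt1.
have [t [_ rt]] := @segment_compact R 0 1 (r @ F) _ rF.
have {}rt (e : R) : 0 < e -> F [set x | `|t - r x| < e].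
  move=> e0; have [//|Fe] := in_ultra_setVsetC [set x | `|t - r x| < e] UF.
  have [||s [hs ht]] :=
    rt [set s | ~ `|t - s| < e] [set s | `|t - s| < e] => //.
  by move/cvgrPdist_lt : (@cvg_id _ (nbhs t)) => /(_ _ e0).
have rE x : base x = proj t + proj (r x - t).
  by rewrite -projD addrC subrK proj_frac.
have [tA|tA] := boolP (proj t \in A); last first.
  exists (split_pt (proj t) false); split=> // U [e e0 eU].
  apply: filterS (rt _ e0) => x /=; rewrite ltr_distlC => /andP[? ?].
  apply: eU; rewrite /split_base base_split_pt (negbTE tA).
  by exists (r x - t) => //; rewrite /= in_itv/=; apply/andP; split; lra.
have [Fl|Fl] := in_ultra_setVsetC [set x | r x < t] UF.
  exists (split_pt (proj t) false); split=> // U [e e0 eU].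
  apply: filterS (filterI Fl (rt _ e0)) => x [/= xt].
  rewrite ltr_distlC => /andP[? ?].
  apply: eU; rewrite /split_base base_split_pt tA; right.
  by exists (r x - t) => //; rewrite /= in_itv/=; apply/andP; split; lra.
have [Fr|Fr] := in_ultra_setVsetC [set x | t < r x] UF.
  exists (split_pt (proj t) true); split=> // U [e e0 eU].
  apply: filterS (filterI Fr (rt _ e0)) => x [/= xt].
  rewrite ltr_distlC => /andP[? ?].
  apply: eU; rewrite /split_base base_split_pt side_split_pt tA; right.
  by exists (r x - t) => //; rewrite /= in_itv/=; apply/andP; split; lra.
have Ft : F [set x | base x = proj t].
  apply: filterS (filterI Fl Fr) => x [/= /negP]; rewrite -leNgt => h1 /negP.
  rewrite -leNgt => h2; rewrite -(proj_frac (base x)); congr proj.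
  by apply/eqP; rewrite eq_le h2.
have [Fs|Fs] := in_ultra_setVsetC [set x | side x] UF.
  exists (split_pt (proj t) true); split=> // U /nbhs_singleton Ux.
  apply: filterS (filterI Fs Ft) => x [/= sx bx].
  rewrite (_ : x = split_pt (proj t) true)//; apply: split_eq => //.
  by rewrite side_split_pt tA.
exists (split_pt (proj t) false); split=> // U /nbhs_singleton Ux.
apply: filterS (filterI Fs Ft) => x [/= /negP/negbTE sx bx].
by rewrite (_ : x = split_pt (proj t) false)//; apply: split_eq.
Qed.

(* The coordinate of [x] along the circle cut open at [a], with values [0] at
   [a^+] and [1] at [a^-]. *)
Let coord (a : circle R) x : R :=
  if base x == a then (if side x then 0 else 1) else frac (base x - a).

Let coord01 a x : 0 <= coord a x <= 1.
Proof.
rewrite /coord; case: ifP => _; first by case: side; rewrite ?lexx ler01.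
by rewrite frac_ge0 ltW ?frac_lt1.
Qed.

Let coordE a x (t : R) : 0 < t < 1 -> base x = a + proj t -> coord a x = t.
Proof.
move=> /andP[t0 t1] xt; rewrite /coord; case: ifPn => [/eqP xa|xa].
  have : t = 0.
    apply: proj_inj; first by rewrite subr0 gtr0_norm.
    by rewrite proj0; apply: (addrI a); rewrite -xt xa addr0.
  by move=> t00; move: t0; rewrite t00 ltxx.
apply: proj_inj; last by rewrite proj_frac xt addrC addKr.
have := frac_ge0 (base x - a); have := frac_lt1 (base x - a).
by rewrite ltr_norml => ? ?; apply/andP; split; lra.
Qed.

Let coordP a x : base x != a ->
  0 < coord a x < 1 /\ base x = a + proj (coord a x).
Proof.
move=> xa; rewrite /coord (negbTE xa) proj_frac; split.
  rewrite frac_lt1 andbT lt_neqAle frac_ge0 andbT; apply: contra xa => /eqP h.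
  by rewrite -subr_eq0 -(proj_frac (base x - a)) -h proj0.
by rewrite addrC subrK.
Qed.

Let coord_cont a : a \in A -> continuous (coord a).
Proof.
move=> aA x; apply/(@cvgrPdist_lt _ _ _ (nbhs x) (nbhs_filter x)) => e e0.
pose d := Num.min e 1; have d0 : 0 < d by rewrite lt_min e0 ltr01.
have [de d1] : d <= e /\ d <= 1 by rewrite /d !ge_min !lexx orbT.
clearbody d.
have [/eqP xa|xa] := boolP (base x == a).
  exists d => // y; rewrite /split_base xa aA => -[->|/=].
    by rewrite subrr normr0.
  rewrite [coord a x]/coord xa eqxx.
  case: side => -[t]; rewrite /= in_itv/= => /andP[? ?] yt.
    rewrite (@coordE a y t) //; last by apply/andP; split; lra.
    by rewrite ltr_norml; apply/andP; split; lra.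
  rewrite (@coordE a y (t + 1)).
  - by rewrite ltr_norml; apply/andP; split; lra.
  - by apply/andP; split; lra.
  rewrite -yt; congr (_ + _); apply/proj_eq.
  by rewrite opprD addrA subrr add0r rpredN rpred1.
have [/andP[c0 c1] xc] := coordP xa.
pose c := coord a x; pose d' := Num.min d (Num.min c (1 - c)).
have d'0 : 0 < d' by rewrite lt_min d0 lt_min c0 subr_gt0.
have [d'd d'c d'c1] : [/\ d' <= d, d' <= c & d' <= 1 - c].
  split; first by rewrite ge_min lexx.
  - by rewrite /d' 2!ge_min lexx orbT.
  - by rewrite /d' 2!ge_min lexx !orbT.
exists d' => // y /(split_base_arc d'0)[t].
rewrite /= in_itv/= => /andP[? ?] yt.
rewrite -/c (@coordE a y (c + t)); last 2 first.
- by apply/andP; split; lra.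
- by rewrite projD addrA -xc.
by rewrite ltr_norml; apply/andP; split; lra.
Qed.

Lemma split_metrizable : A !=set0 -> countable A ->
  exists d : X -> X -> R, compatible_metric d.
Proof.
move=> [a0 a0A] /pfcard_geP[/seteqP[/(_ a0 a0A)]//|[g]].
have gA k : g k \in A by rewrite inE; exact: (@funS _ _ _ _ g).
apply: (@separating_metrizable _ _ (fun k => coord (g k))).
- exact: split_compact.
- by move=> k x; exact: coord01.
- by move=> k; exact: coord_cont.
move=> x y h.
have bxy : base x = base y.
  have := h 0; have [/eqP xa|xa] := boolP (base x == g 0);
    have [/eqP ya|ya] := boolP (base y == g 0).
  - by rewrite xa ya.
  - have [/andP[y0 y1] _] := coordP ya; rewrite {1}/coord xa eqxx.
    by case: side => E; move: y0 y1; rewrite -E ltxx.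
  - have [/andP[y0 y1] _] := coordP xa; rewrite {2}/coord ya eqxx.
    by case: side => E; move: y0 y1; rewrite E ltxx.
  - by have [_ ->] := coordP xa; have [_ ->] := coordP ya => ->.
apply: split_eq => //.
have [xA|xA] := boolP (base x \in A); last first.
  have /contraNF -/(_ xA) -> := @side_in x.
  by move: xA; rewrite bxy => xA; have /contraNF -/(_ xA) -> := @side_in y.
have [k _ gk] : (g @` setT) (base x) by rewrite (@image_eq _ _ _ _ g) -inE.
have := h k; rewrite /coord -bxy gk eqxx.
by case: side; case: side => // /eqP; rewrite ?oner_eq0 // eq_sym oner_eq0.
Qed.

End split_space.

Section split_map.
Context {R : realType} {A : set (circle R)} (alpha : R).
Hypothesis Ainv : rotation alpha @` A = A.

(* [theta^- |-> (theta + alpha)^-] and [theta^+ |-> (theta + alpha)^+] *)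
Definition split_map (x : split_space A) : split_space A :=
  split_pt (rotation alpha (base x)) (side x).

Lemma rotation_in theta : (rotation alpha theta \in A) = (theta \in A).
Proof.
apply/idP/idP; rewrite !inE => h; last by rewrite -Ainv; exists theta.
by move: h; rewrite -{1}Ainv => -[eta etaA /addIr <-].
Qed.

Lemma side_split_map x : side (split_map x) = side x.
Proof.
rewrite side_split_pt rotation_in; have [/side_in ->//|] := boolP (side x).
by [].
Qed.

Lemma split_map_continuous : continuous split_map.
Proof.
move=> x U [e e0 eU]; exists e => // y xy; apply: eU; move: xy.
rewrite /split_base side_split_map base_split_pt rotation_in.
case: ifP => _.
  case=> [->|h]; [by left|right; move: h].
  by case: side => h /=; rewrite -arc_rotation; exists (base y).
by move=> h /=; rewrite -arc_rotation; exists (base y).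
Qed.

End split_map.

Lemma rotationK (R : realType) (alpha : R) :
  cancel (rotation alpha) (rotation (- alpha)).
Proof. by move=> theta; rewrite /rotation projN addrK. Qed.

Lemma rotationNK (R : realType) (alpha : R) :
  cancel (rotation (- alpha)) (rotation alpha).
Proof. by move=> theta; rewrite /rotation projN subrK. Qed.

Lemma rotationN_inv (R : realType) (alpha : R) (A : set (circle R)) :
  rotation alpha @` A = A -> rotation (- alpha) @` A = A.
Proof.
move=> Ainv; apply/seteqP; split=> [_ [theta tA <-]|theta tA].
  by rewrite -inE -(rotation_in Ainv) rotationNK inE.
by exists (rotation alpha theta); rewrite ?rotationK// -Ainv; exists theta.
Qed.

Lemma split_mapK (R : realType) (alpha : R) (A : set (circle R)) :
  rotation alpha @` A = A ->
  cancel (split_map alpha) (split_map (A := A) (- alpha)).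
Proof.
move=> Ainv x; apply: split_eq; first by rewrite !base_split_pt rotationK.
by rewrite (side_split_map (rotationN_inv Ainv)) side_split_map.
Qed.

Lemma split_mapNK (R : realType) (alpha : R) (A : set (circle R)) :
  rotation alpha @` A = A ->
  cancel (split_map (- alpha)) (split_map (A := A) alpha).
Proof.
move=> Ainv x; apply: split_eq; first by rewrite !base_split_pt rotationNK.
by rewrite (side_split_map Ainv) (side_split_map (rotationN_inv Ainv)).
Qed.

Definition split_cascade (R : realType) (alpha : R) (A : set (circle R))
    (A0 : A !=set0) (Acount : countable A)
    (Ainv : rotation alpha @` A = A) : cascade R :=
  {| cascade_space := split_space A;
     cascade_compact := split_compact;
     cascade_metrizable := split_metrizable A0 Acount;
     cascade_map := split_map alpha;
     cascade_inv := split_map (- alpha);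
     cascade_mapK := split_mapK Ainv;
     cascade_invK := split_mapNK Ainv;
     cascade_map_continuous := split_map_continuous Ainv;
     cascade_inv_continuous := split_map_continuous (rotationN_inv Ainv) |}.
Arguments split_cascade {R} alpha A A0 Acount Ainv.

(* Main.v *)
Require Import Defs.
From mathcomp Require Import all_boot all_order all_algebra.
From mathcomp Require Import all_classical all_reals all_analysis.
From mathcomp Require Import lra.

(** Tameness.  Let [X] be the split system, [T] its homeomorphism.  A limit of
    powers [T^n_i] must translate base points by [beta := lim n_i alpha].  If
    the [n_i alpha] approach [beta] strictly from the right, every point is
    sent to the right-hand copy over its translate, and symmetrically from the
    left; if they do not stay on one side, or hit [beta], the limit is already
    a power of [T].  Hence the enveloping semigroup is contained in
    [{T^n} u {p_beta^+} u {p_beta^-}] ([enveloping_semigroup_sub]).  The first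
    set is countable.  The map [t |-> p_t^+] from [R] to [X^X] is continuous
    from the right ([split_pt_right]), that is, continuous for the Sorgenfrey
    topology, and the Sorgenfrey line is hereditarily separable
    ([sorgenfrey_separable]); so its range is hereditarily separable, and
    likewise for [p_beta^-].

    Sensitivity.  Fix [a] in [A].  By density of the orbits of an irrational
    rotation ([irrational_orbit_dense]) every nonempty open set of [X] contains
    both points over [a - n alpha] for some [n].  Its image under [T^n] then
    contains [a^-] and [a^+], whose distance does not depend on the open set.
    So [X] itself, as a closed invariant subset of [X], is sensitive. *)

(* [arc], [frac] and [proj] also name notions of the other libraries; here they
   are those of the circle. *)
Import Defs.
Import Order.TTheory GRing.Theory Num.Theory.
Import numFieldNormedType.Exports.
Local Open Scope classical_set_scope.
Local Open Scope ring_scope.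
Set Implicit Arguments.
Unset Strict Implicit.

(** * Density of irrational rotations *)

(** Either the subgroup has arbitrarily small positive elements, whose multiples
    meet every interval, or its positive elements are bounded away from [0].
    Their infimum is then attained, since two elements close to it from above
    would differ by a smaller positive element, and it generates the
    subgroup. *)
Lemma subgroup_cyclic_or_dense (R : realType) (G : set R) :
  (forall x y, G x -> G y -> G (x - y)) ->
  (exists s, forall x, G x -> exists k : int, x = s *~ k) \/
  (forall u v, u < v -> exists2 g, G g & u < g < v).
Proof.
move=> GB; pose P := [set x | G x /\ 0 < x].
have G0 x : G x -> G 0 by move=> Gx; rewrite -(subrr x); exact: GB.
have GN x : G x -> G (- x).
  by move=> Gx; rewrite -sub0r; apply: GB => //; exact: G0 Gx.
have GMz x (k : int) : G x -> G (x *~ k).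
  move=> Gx; have GMn (n : nat) : G (x *+ n).
    elim: n => [|n IH]; first by rewrite mulr0n; exact: G0 Gx.
    by rewrite mulrSr -[X in _ + X]opprK; apply: GB => //; exact: GN.
  by case: k => n; rewrite ?NegzE ?mulrNz -pmulrn//; exact/GN/GMn.
have [[e e0 Pe]|small] := pselect (exists2 e, 0 < e & forall x, P x -> e <= x);
    last first.
  right=> u v uv; have [g [Gg g0] gv] : exists2 g, P g & g < v - u.
    apply: contrapT => h; apply: small; exists (v - u).
      by rewrite subr_gt0.
    by move=> x Px; rewrite leNgt; apply/negP => xv; apply: h; exists x.
  exists (g *~ (Num.floor (u / g) + 1)); first exact: GMz.
  have h1 : u < g *~ (Num.floor (u / g) + 1).
    by rewrite -mulrzr mulrC -ltr_pdivrMr// floorD1_gt.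
  rewrite h1/= mulrzDr mulr1z.
  have : g *~ Num.floor (u / g) <= u.
    by rewrite -mulrzr mulrC -ler_pdivlMr// floor_le.
  by move=> h2; lra.
(* The trivial subgroup has no positive element, and is generated by 0. *)
left; have [[p Pp]|P0] := pselect (P !=set0); last first.
  exists 0 => x Gx; exists 0; rewrite mulr0z; apply/eqP.
  apply: contrapT => /negP; rewrite neq_lt => /orP[x0|x0]; apply: P0.
    by exists (- x); split; [exact: GN|rewrite oppr_gt0].
  by exists x.
have Plb : has_lbound P by exists e => x /Pe.
have Pinf : has_inf P by split=> //; exists p.
pose s := inf P.
have s0 : 0 < s by apply: lt_le_trans e0 _; apply: lb_le_inf; [exists p|].
have Ps : P s.
  apply: contrapT => nPs.
  have [g [Gg g0] gs] := inf_adherent s0 Pinf.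
  have sg : s < g by exact: (inf_lb_strict Plb nPs).
  have [h [Gh h0] hg] : exists2 h, P h & h < s + (g - s).
    by apply: inf_adherent => //; rewrite subr_gt0.
  have sh : s < h by exact: (inf_lb_strict Plb nPs).
  have : s <= g - h.
    by apply: (ge_inf Plb); split; [exact: GB|lra].
  rewrite -/s in gs; lra.
exists s => x Gx; exists (Num.floor (x / s)).
have h1 : s *~ Num.floor (x / s) <= x.
  by rewrite -mulrzr mulrC -ler_pdivlMr// floor_le.
have h2 : x < s *~ Num.floor (x / s) + s.
  rewrite -[X in _ + X]mulr1z -mulrzDr -mulrzr mulrC -ltr_pdivrMr//.
  exact: floorD1_gt.
apply/eqP; rewrite eq_le h1 andbT leNgt; apply/negP => h3.
have : s <= x - s *~ Num.floor (x / s).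
  apply: (ge_inf Plb); split; last by rewrite subr_gt0.
  by apply: GB => //; apply: GMz; case: Ps.
lra.
Qed.

(** The subgroup [Z alpha + Z] is not cyclic: a generator [s] would have [1] and
    [alpha] as integer multiples, making [alpha] rational. *)
Lemma irrational_orbit_dense (R : realType) (alpha u v : R) :
  irrational alpha -> u < v ->
  exists n m : int, u < alpha *~ n + m%:~R < v.
Proof.
move=> irr uv.
pose G := [set x : R | exists n m : int, x = alpha *~ n + m%:~R].
have [|[s Gs]|dense] := @subgroup_cyclic_or_dense R G.
- move=> _ _ [n [m ->]] [n' [m' ->]]; exists (n - n'), (m - m').
  by rewrite mulrzBr rmorphB/=; lra.
- have [k sk] : exists k : int, 1 = s *~ k.
    by apply: Gs; exists 0, 1; rewrite mulr0z add0r.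
  have [l sl] : exists l : int, alpha = s *~ l.
    by apply: Gs; exists 1, 0; rewrite mulr1z addr0.
  case: irr; exists (l%:~R / k%:~R) => //.
  have k0 : k%:~R != 0 :> R.
    apply/eqP => k0; have := oner_neq0 R.
    by rewrite sk -mulrzr k0 mulr0 eqxx.
  rewrite fmorph_div/= !ratr_int.
  rewrite -mulrzr in sk; rewrite -mulrzr in sl; rewrite sl.
  have -> : s = k%:~R^-1 by apply: (mulIf k0); rewrite -sk mulVf.
  exact: mulrC.
- by have [_ [n [m ->]] ?] := dense _ _ uv; exists n, m.
Qed.

(** * Hereditary separability and one-sided continuity *)

(** A subset of the Sorgenfrey line is separable.  The points of [S] isolated
    from the right in [S] must all be in [D]; they are countably many because
    the gaps to their right are disjoint, and each contains a rational.  Any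
    other point is approached from the right within [S], and one point of [S]
    in each rational interval suffices for these. *)
Lemma sorgenfrey_separable (R : realType) (S : set R) :
  exists D, [/\ D `<=` S, countable D & forall t, S t -> D t \/
    forall e, 0 < e -> exists2 s, D s & t < s < t + e].
Proof.
pose I := [set s | S s /\
  exists2 e, 0 < e & forall s', S s' -> ~ (s < s' < s + e)].
have Icount : countable I.
  (* [ratr (r s)] lies between [s] and the next points of [S]. *)
  have /choice[r rP] s : exists q : rat, I s ->
      s < ratr q /\ forall s', S s' -> s < s' -> ratr q < s'.
    have [[Ss [e e0 gap]]|] := pselect (I s); last by exists 0.
    have [q] : exists q, ratr q \in `]s, s + e[ by apply: rat_in_itvoo; lra.
    rewrite in_itv/= => /andP[sq qe]; exists q => _; split=> // s' Ss' ss'.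
    rewrite (lt_le_trans qe)// leNgt; apply/negP => s'e.
    by apply: (gap _ Ss'); rewrite ss'.
  apply/countable_injP; exists (choice.pickle \o r) => s t.
  rewrite !inE => Is It /(pcan_inj choice.pickleK) rst.
  have [sr gs] := rP _ Is; have [tr gt] := rP _ It.
  have [st|ts|//] := ltgtP s t.
    by have := gs _ It.1 st; rewrite rst ltNge ltW.
  by have := gt _ Is.1 ts; rewrite -rst ltNge ltW.
pose h (pq : rat * rat) := xget 0 (S `&` `]ratr pq.1, ratr pq.2[).
exists (I `|` S `&` range h); split.
- by move=> s [[]|[]].
- rewrite -bigcup2E; apply: bigcup_countable => // -[|[|i]] _ //=.
  apply: sub_countable (subset_card_le _) _; first exact: subIsetr.
  exact: sub_countable (card_image_le _ _) _.
move=> t St; have [It|nIt] := pselect (I t); [by left; left|right=> e e0].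
have [s Ss /andP[ts se]] : exists2 s, S s & t < s < t + e.
  apply: contrapT => no; apply: nIt; split=> //; exists e => // s Ss tse.
  by apply: no; exists s.
have [p] := rat_in_itvoo ts; rewrite in_itv/= => /andP[tp ps].
have [q] := rat_in_itvoo se; rewrite in_itv/= => /andP[sq qe].
have [hS] : (S `&` `]ratr p, ratr q[) (h (p, q)).
  by apply: (@xgetPex _ 0); exists s; split=> //=; rewrite in_itv/= ps.
rewrite /= in_itv/= => /andP[ph hq]; exists (h (p, q)).
  by right; split=> //; exists (p, q).
by rewrite (lt_trans tp)//= (lt_trans hq).
Qed.

Section separability.
Context {Y : topologicalType}.

Lemma hereditarily_separableW (E F : set Y) :
  F `<=` E -> hereditarily_separable E -> hereditarily_separable F.
Proof. by move=> FE hE S SF; apply: hE; exact: subset_trans SF FE. Qed.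

Lemma countable_hereditarily_separable (E : set Y) :
  countable E -> hereditarily_separable E.
Proof.
move=> cE S SE; exists S; split=> //; last exact: subset_closure.
exact: sub_countable (subset_card_le SE) cE.
Qed.

Lemma hereditarily_separableU (E F : set Y) :
  hereditarily_separable E -> hereditarily_separable F ->
  hereditarily_separable (E `|` F).
Proof.
move=> hE hF S SEF.
have [D [DS cD SD]] := hE (S `&` E) (@subIsetr _ _ _).
have [D' [DS' cD' SD']] := hF (S `&` F) (@subIsetr _ _ _).
exists (D `|` D'); split.
- by move=> s [/DS[]|/DS'[]].
- by rewrite -bigcup2E; apply: bigcup_countable => // -[|[|i]] _ /=.
move=> s Ss; rewrite closureU.
by case: (SEF s Ss) => ?; [left; apply: SD|right; apply: SD'].
Qed.

(** Right continuity is continuity for the Sorgenfrey topology, and hereditary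
    separability passes to continuous images. *)
Lemma right_continuous_hereditarily_separable (R : realType) (g : R -> Y) :
  (forall t, g s @[s --> t^'+] --> g t) -> hereditarily_separable (range g).
Proof.
move=> gc S Sg; have [D [DS cD Dd]] := sorgenfrey_separable (g @^-1` S).
exists (g @` D); split.
- by move=> _ [s Ds <-]; exact: DS.
- exact: sub_countable (card_image_le _ _) _.
move=> y Sy; have [t _ ty] := Sg y Sy; rewrite -ty in Sy *.
have [Dt|tD] := Dd t Sy; first by apply: subset_closure; exists t.
move=> U /gc; rewrite nbhs_filterE => -[e /= e0 eU].
have [s Ds /andP[ts se]] := tD e e0.
exists (g s); split; first by exists s.
by apply: eU => //=; rewrite ltr_distlC; apply/andP; split; lra.
Qed.

Lemma left_continuous_hereditarily_separable (R : realType) (g : R -> Y) :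
  (forall t, g s @[s --> t^'-] --> g t) -> hereditarily_separable (range g).
Proof.
move=> gc; apply: (@hereditarily_separableW (range (g \o -%R))).
  by move=> _ [t _ <-]; exists (- t) => //=; rewrite opprK.
apply: right_continuous_hereditarily_separable => t /=.
have /cvg_at_leftNP := gc (- t); by rewrite opprK.
Qed.

End separability.

(** * Arcs of the circle *)

Section circle.
Context {R : realType}.
Implicit Types beta gamma : circle R.

Lemma arc_hausdorff beta gamma :
  (forall e, 0 < e -> arc beta (- e) e gamma) -> gamma = beta.
Proof.
move=> near; apply/eqP; rewrite -subr_eq0 -(proj_frac (gamma - beta)).
have c0 := frac_ge0 (gamma - beta); have c1 := frac_lt1 (gamma - beta).
have cE := proj_frac (gamma - beta).
set c := frac _ in c0 c1 cE *; clearbody c.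
have [->|cn0] := eqVneq c 0; first by rewrite proj0.
have {cn0}c0 : 0 < c by rewrite lt_neqAle eq_sym cn0.
have [|t] := near (Num.min c (1 - c)); first by rewrite lt_min c0 subr_gt0.
rewrite /= in_itv/= ltrNl !lt_min => /andP[/andP[t1 t2] /andP[t3 t4]] tE.
have : c = t.
  apply: proj_inj; first by rewrite ltr_norml; apply/andP; split; lra.
  by rewrite cE -tE addrC addKr.
lra.
Qed.

(** Opposite arcs from [beta] could only meet by going around the circle, hence
    the bound on the sum of their lengths. *)
Lemma arc_sides beta gamma (e e' : R) : e + e' <= 1 ->
  arc beta (- e) 0 gamma -> arc beta 0 e' gamma -> False.
Proof.
move=> ee [s]; rewrite /= in_itv/= => /andP[s1 s2] <- [t].
rewrite /= in_itv/= => /andP[t1 t2] /addrI/proj_inj ts.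
have : t = s by apply: ts; rewrite ltr_norml; apply/andP; split; lra.
lra.
Qed.

Lemma arc_endpoint beta (e : R) : e <= 1 ->
  ~ arc beta 0 e beta /\ ~ arc beta (- e) 0 beta.
Proof.
move=> e1; split=> -[t]; rewrite /= in_itv/= => /andP[t1 t2] tE;
  have : t = 0.
  - by apply: proj_inj; rewrite ?subr0 ?gtr0_norm ?(lt_le_trans t2)//;
      apply: (addrI beta); rewrite tE proj0 addr0.
  - by lra.
  - apply: proj_inj; last by apply: (addrI beta); rewrite tE proj0 addr0.
    by rewrite ltr_norml; apply/andP; split; lra.
  - by lra.
Qed.

End circle.

(** * The split circle *)

Section split_space_facts.
Context {R : realType} {A : set (circle R)}.
Local Notation X := (split_space A).
Implicit Types x y : X.

(** The one-sided neighborhoods of [a^-] and [a^+] leave out the other point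
    over [a]. *)
Lemma split_base_fiber x y (e : R) : e <= 1 ->
  split_base x e y -> base y = base x -> y = x.
Proof.
move=> e1; rewrite /split_base; case: ifPn => [xA|xA _ yx].
  case=> [-> //|+ yx]; rewrite /= yx.
  by have [nr nl] := arc_endpoint (base x) e1; case: (side x) => [/nr|/nl].
apply: split_eq => //; have side0 (z : X) : base z = base x -> side z = false.
  by move=> zx; apply/negP => /side_in; rewrite zx (negbTE xA).
by rewrite !side0.
Qed.

(** Points over the arc [(theta + t, theta + t + e)] are close to the right-hand
    point over [theta + t], whichever copy they are; in particular this covers
    the case where [theta + t] is not split. *)
Lemma split_pt_right theta (t : R) :
  split_pt (theta + proj s) true @[s --> t^'+] -->
    (split_pt (theta + proj t) true : X).
Proof.
move=> U [e /= e0 eU]; rewrite nbhs_filterE.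
have : \forall s \near t^'+, t < s < t + e.
  apply: filterS2 (nbhs_right_gt t) (nbhs_right_lt (_ : t < t + e)).
    by move=> s -> ->.
  by rewrite ltrDl.
apply: filterS => s /andP[ts se]; apply: eU.
have E : theta + proj s = theta + proj t + proj (s - t).
  by rewrite -addrA -projD [t + _]addrC subrK.
rewrite /split_base side_split_pt base_split_pt.
have [_|_] := boolP (_ \in A); [right|];
  exists (s - t) => //=; rewrite in_itv/=; apply/andP; split; lra.
Qed.

Lemma split_pt_left theta (t : R) :
  split_pt (theta + proj s) false @[s --> t^'-] -->
    (split_pt (theta + proj t) false : X).
Proof.
move=> U [e /= e0 eU]; rewrite nbhs_filterE.
have : \forall s \near t^'-, t - e < s < t.
  apply: filterS2 (nbhs_left_lt t) (nbhs_left_gt (_ : t - e < t)).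
    by move=> s -> ->.
  by rewrite ltrBlDr ltrDl.
apply: filterS => s /andP[ts se]; apply: eU.
have E : theta + proj s = theta + proj t + proj (s - t).
  by rewrite -addrA -projD [t + _]addrC subrK.
rewrite /split_base side_split_pt base_split_pt.
have [_|_] := boolP (_ \in A); [right|];
  exists (s - t) => //=; rewrite in_itv/=; apply/andP; split; lra.
Qed.

Lemma split_open_arc (U : set X) x : nbhs x U ->
  exists theta u v, u < v /\ base @^-1` arc theta u v `<=` U.
Proof.
move=> [e /= e0 eU]; exists (base x).
suff [u [v [uv h]]] : exists u v, u < v /\
    base @^-1` arc (base x) u v `<=` split_base x e.
  by exists u, v; split=> //; exact: subset_trans eU.
rewrite /split_base; case: ifP => _; last by exists (- e), e; split=> //; lra.
by case: (side x); [exists 0, e|exists (- e), 0]; (split; first by lra);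
  move=> y h; right.
Qed.

End split_space_facts.

(** * The topology of pointwise convergence *)

Lemma cvg_ptws (I : eqType) (Y : topologicalType) (F : set_system (I -> Y))
    (f : I -> Y) : Filter F ->
  (forall i, g i @[g --> F] --> f i) -> {ptws, F --> f}.
Proof.
move=> FF Fi; apply/cvg_sup => i U [_ [[V oV <-] Vfi VU]].
apply: filterS VU _; apply: Fi; exact: open_nbhs_nbhs.
Qed.

Lemma ptws_closure_approx (I : eqType) (Y : topologicalType)
    (S : set (I -> Y)) (f : I -> Y) (V : I -> set Y) (s : seq I) :
  closure (S : set {ptws I -> Y}) f -> (forall i, nbhs (f i) (V i)) ->
  exists2 g, S g & {in s, forall i, V i (g i)}.
Proof.
move=> Sf fV; have FF := @nbhs_filter {ptws I -> Y} f.
have [|g [Sg gV]] := Sf [set g | {in s, forall i, V i (g i)}].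
  elim: s => [|i s IH]; first by apply: filterS filterT => g _ i.
  have Vi : nbhs (f : {ptws I -> Y}) [set g : I -> Y | V i (g i)].
    exact: (@proj_continuous I (fun=> Y) i f _ (fV i)).
  apply: filterS (filterI Vi IH) => g [gi gs] j.
  by rewrite inE => /orP[/eqP ->|/gs].
by exists g.
Qed.

(** * The split cascade *)

Section split_cascade.
Context {R : realType} (alpha : R) (A : set (circle R)).
Hypotheses (A0 : A !=set0) (Acount : countable A).
Hypothesis Ainv : rotation alpha @` A = A.
Local Notation X := (split_cascade alpha A A0 Acount Ainv).
Local Notation T n := (@cascade_iter R X n).
Implicit Types (x y : X) (f : X -> X).

Lemma cascade_iter_base_side n x :
  base (T n x) = base x + proj (alpha *~ n) /\ side (T n x) = side x.
Proof.
case: n => n /=.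
  elim: n => [|n [IHb IHs]]; first by rewrite mulr0z proj0 addr0.
  rewrite /= side_split_map// base_split_pt IHb IHs; split=> //.
  by rewrite /rotation -addrA -projD -!pmulrn mulrSr.
have Ninv := rotationN_inv Ainv.
elim: n => [|n [IHb IHs]].
  by rewrite /= side_split_map// base_split_pt /rotation NegzE mulrNz mulr1z.
rewrite iterS side_split_map// base_split_pt IHb IHs; split=> //.
rewrite /rotation -addrA -projD !NegzE !mulrNz -!pmulrn [in RHS]mulrSr.
by rewrite opprD.
Qed.

Lemma cascade_iter_split_pt n x :
  T n x = split_pt (base x + proj (alpha *~ n)) (side x).
Proof.
have [Tb Ts] := cascade_iter_base_side n x.
by rewrite -[LHS]split_ptE Tb Ts.
Qed.

(** The map written [p_beta^+] or [p_beta^-] above, according to [s]. *)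
Definition one_sided_translation (s : bool) (beta : circle R) : X -> X :=
  fun x => split_pt (base x + beta) s.

Lemma enveloping_approx f (s : seq X) (e : R) : enveloping_semigroup X f ->
  0 < e -> exists n, {in s, forall x, split_base (f x) e (T n x)}.
Proof.
move=> Ef e0.
have [|_ [n _ <-] h] := @ptws_closure_approx X X (range (@cascade_iter R X))
    f (fun x => split_base (f x) e) s Ef.
  by move=> x; exists e.
by exists n.
Qed.

(** All points are moved along the circle by the same [n alpha] under [T^n], so
    the displacements of two points under a limit differ by less than any
    [e]. *)
Lemma enveloping_translation f : enveloping_semigroup X f ->
  exists beta, forall x, base (f x) = base x + beta.
Proof.
move=> Ef; have [a aA] := A0; pose x0 : X := split_pt a false.
exists (base (f x0) - base x0) => x; apply: arc_hausdorff => e e0.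
have e20 : 0 < e / 2 by rewrite divr_gt0.
have [n near] := enveloping_approx [:: x; x0] Ef e20.
have := split_base_arc e20 (near x0 _); rewrite !inE eqxx orbT => /(_ isT).
have := split_base_arc e20 (near x _); rewrite !inE eqxx => /(_ isT).
rewrite /= !(cascade_iter_base_side n _).1.
move=> [t]; rewrite /= in_itv/= => /andP[t1 t2] tE.
move=> [s]; rewrite /= in_itv/= => /andP[s1 s2] sE.
exists (s - t); first by rewrite /= in_itv/=; apply/andP; split; lra.
have -> : base (f x) = base x + proj (alpha *~ n) - proj t by rewrite -tE addrK.
have -> : base (f x0) - base x0 = proj (alpha *~ n) - proj s.
  by apply/eqP; rewrite subr_eq addrC addrA -sE addrK.
by rewrite projD projN !addrA subrK.
Qed.

(** If [f] is neither [p_beta^+] nor [p_beta^-], some [f x] is a left-hand point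
    and some [f y] a right-hand point over points of [A].  A power of [T] close
    to [f] at [x] has [n alpha] at [beta] or to its left, and if it is close to
    [f] at [y] it has [n alpha] at [beta] or to its right; so it is the
    translation by exactly [beta], and all powers close to [f] coincide. *)
Lemma enveloping_semigroup_sub : enveloping_semigroup X `<=`
  range (@cascade_iter R X) `|`
  (range (one_sided_translation true) `|` range (one_sided_translation false)).
Proof.
move=> f Ef; have [beta fb] := enveloping_translation Ef.
have [[x fx]|fT] :=
    pselect (exists x, f x <> one_sided_translation true beta x); last first.
  right; left; exists beta => //; apply/funext => x.
  by apply: contrapT => h; apply: fT; exists x => /esym.
have [[y fy]|fF] :=
    pselect (exists y, f y <> one_sided_translation false beta y); last first.
  right; right; exists beta => //; apply/funext => y.
  by apply: contrapT => h; apply: fF; exists y => /esym.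
left.
have fE z : f z = split_pt (base z + beta) (side (f z)).
  by rewrite -fb split_ptE.
have sx : side (f x) = false.
  by apply/negP => sx; apply: fx; rewrite fE sx.
have sy : side (f y).
  by apply: contrapT => /negP/negbTE sy; apply: fy; rewrite fE sy.
have xA : base (f x) \in A.
  apply: contrapT => /negP/negbTE xA; apply: fx; rewrite fE sx.
  by apply: split_eq => //; rewrite !side_split_pt -fb xA andbF.
have yA : base (f y) \in A by exact: side_in.
have e20 : 0 < 2^-1 :> R by rewrite invr_gt0.
(* A third point [z] is added, to conclude that [f z] itself is reached. *)
have approx z : exists2 n, proj (alpha *~ n) = beta & T n z = f z.
  have [n near] := enveloping_approx [:: x; y; z] Ef e20.
  have nb : proj (alpha *~ n) = beta.
    have := near x; rewrite inE eqxx => /(_ isT).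
    rewrite /split_base xA sx => -[Tx|/= Tx].
      apply: (addrI (base x)); rewrite -fb -Tx.
      by rewrite (cascade_iter_base_side n x).1.
    have := near y; rewrite !inE eqxx orbT => /(_ isT).
    rewrite /split_base yA sy => -[Ty|/= Ty].
      apply: (addrI (base y)); rewrite -fb -Ty.
      by rewrite (cascade_iter_base_side n y).1.
    exfalso; move: Tx Ty; rewrite !fb !(cascade_iter_base_side n _).1.
    move=> [t tI tE] [s sI sE].
    apply: (@arc_sides _ beta (proj (alpha *~ n)) 2^-1 2^-1).
    - lra.
    - by exists t => //; apply: (addrI (base x)); rewrite addrA.
    - by exists s => //; apply: (addrI (base y)); rewrite addrA.
  exists n => //; apply: split_base_fiber (near z _) _.
  - lra.
  - by rewrite !inE eqxx !orbT.
  - by rewrite fb -nb (cascade_iter_base_side n z).1.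
have [n nb _] := approx x; exists n => //; apply/funext => z.
have [m mb <-] := approx z.
by rewrite !cascade_iter_split_pt nb mb.
Qed.

Lemma split_cascade_tame2 : tame2 X.
Proof.
apply: (hereditarily_separableW enveloping_semigroup_sub).
have rangeE s : range (one_sided_translation s) =
    range (fun t : R => one_sided_translation s (proj t)).
  apply/seteqP; split=> [_ [b _ <-]|_ [t _ <-]]; last by exists (proj t).
  by exists (repr b) => //; rewrite proj_repr.
apply: hereditarily_separableU.
  apply: countable_hereditarily_separable.
  exact: sub_countable (card_image_le _ _) _.
apply: hereditarily_separableU; rewrite rangeE.
  apply: right_continuous_hereditarily_separable => t.
  apply: cvg_ptws => x; exact: split_pt_right.
apply: left_continuous_hereditarily_separable => t.
apply: cvg_ptws => x; exact: split_pt_left.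
Qed.

(** The sensitivity constant is the distance from [a^+] to [a^-], for one [a] in
    [A]. *)
Lemma split_cascade_sensitive (d : X -> X -> R) : irrational alpha ->
  compatible_metric d -> ~ nonsensitive d [set: X].
Proof.
move=> irr [d0 dC dt _] ns; have [a /mem_set aA] := A0.
pose p s : X := split_pt a s.
have dp : 0 < d (p true) (p false).
  have dge0 : 0 <= d (p true) (p false).
    have /d0 pp : p true = p true by [].
    by have := dt (p true) (p false) (p true); rewrite pp (dC (p false)); lra.
  rewrite lt_neqAle dge0 andbT; apply/eqP => /esym/d0/(congr1 side).
  by rewrite !side_split_pt aA.
have [U [oU [x [Ux _]] small]] := ns _ dp.
have [theta [u [v [uv UU]]]] := split_open_arc (open_nbhs_nbhs (conj oU Ux)).
pose c := frac (a - theta).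
have [|n [m nm]] := @irrational_orbit_dense R alpha (c - v) (c - u) irr.
  lra.
have inU s : U (split_pt (a - proj (alpha *~ n)) s).
  apply: UU; exists (c - (alpha *~ n + m%:~R)).
    by move: nm; rewrite /= in_itv/= => /andP[? ?]; apply/andP; split; lra.
  rewrite /= base_split_pt -(subrK theta a) -(proj_frac (a - theta)) -/c.
  have -> : proj (c - (alpha *~ n + m%:~R)) = proj (c - alpha *~ n).
    apply/proj_eq; rewrite (_ : _ - _ = - m%:~R); last by lra.
    by rewrite rpredN intr_int.
  by rewrite projD projN addrA [theta + _]addrC.
have TU s : (T n @` (U `&` setT)) (p s).
  exists (split_pt (a - proj (alpha *~ n)) s); first by split=> //; exact: inU.
  rewrite cascade_iter_split_pt base_split_pt subrK.
  apply: split_eq => //; rewrite !side_split_pt aA !andbT.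
  suff -> : a - proj (alpha *~ n) \in A by rewrite andbT.
  (* [a] is split, so its translate is split too: [T] preserves sides. *)
  pose w : X := split_pt a true.
  have := @side_in _ _ (T (- n) w).
  have [-> ->] := cascade_iter_base_side (- n) w.
  by rewrite side_split_pt aA => /(_ isT); rewrite mulrNz projN.
have := small n; rewrite ltNge => /negP; apply.
apply: ereal_sup_ubound; exists (p true, p false) => //.
by split; exact: TU.
Qed.

End split_cascade.

Theorem corollary8p3 (R : realType) (alpha : R) (A : set (circle R))
    (alpha_irrational : irrational alpha)
    (A_neq0 : A !=set0) (A_countable : countable A)
    (A_invariant : rotation alpha @` A = A) :
  tame2 (split_cascade alpha A A_neq0 A_countable A_invariant) /\
  ~ HNS (split_cascade alpha A A_neq0 A_countable A_invariant).
Proof.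
split; first exact: split_cascade_tame2.
have [d dm] := split_metrizable A_neq0 A_countable => hns.
apply: (split_cascade_sensitive alpha_irrational dm).
have [a _] := A_neq0.
apply: (hns d dm); first by exists (split_pt a false).
  exact: closedT.
apply/seteqP; split=> // x _; exists (split_map (- alpha) x) => //.
exact: split_mapNK.
Qed.
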